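(* Let $p=3$, let $n\geq 2$ be an integer and $q\in U^{(1)}-U^{(2)}$. Let $z_0\in\mathbb{Z}_3$ be a modular fixed point of $[\iota_q]_{3^n}$ such that $v_0:=v(z_0(z_0-1))$ is the smallest nonzero value of $v(z(z-1))$ among all modular fixed points $z$ of $[\iota_q]_{3^n}$. Let $\tau=3^{n-v_0-1}$. (a) If $q\equiv 7\pmod 9$, the set of all modular fixed points of $[\iota_q]_{3^n}$ in $\mathbb{Z}_3$ is $$\begin{cases}(z_0+\tau\mathbb{Z}_3)\cup\tau\mathbb{Z}_3\cup(1+3^{n-1}\mathbb{Z}_3) & \text{if } v_0<\frac{n-1}{2},\\ 3^{\lfloor n/2\rfloor}\mathbb{Z}_3\cup(1+3^{n-1}\mathbb{Z}_3) & \text{if } v_0\geq\frac{n-1}{2}.\end{cases}$$ (b) If $q\equiv 4\pmod 9$, the set of all modular fixed points of $[\iota_q]_{3^n}$ in $\mathbb{Z}_3$ is $$\begin{cases}(z_0+\tau\mathbb{Z}_3)\cup(1+\tau\mathbb{Z}_3)\cup 3^{n-1}\mathbb{Z}_3 & \text{if } v_0<\frac{n-1}{2},\\ (1+3^{\lfloor n/2\rfloor}\mathbb{Z}_3)\cup 3^{n-1}\mathbb{Z}_3 & \text{if } v_0\geq\frac{n-1}{2}.\end{cases}$$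
   Context: $\mathbb{Z}_3$ is the ring of $3$-adic integers with additive valuation $v=v_3$, and $U^{(m)}=1+3^m\mathbb{Z}_3$. For $q\in U^{(1)}$, $\iota_q:\mathbb{Z}_3\to\mathbb{Z}_3$ is the unique continuous function with $\iota_q(k)=1+q+\cdots+q^{k-1}$ for all integers $k\ge 0$; thus $\iota_q(z)=(q^z-1)/(q-1)$ for $q\ne1$. $[\iota_q]_{3^n}$ is its reduction modulo $3^n$, and $z\in\mathbb{Z}_3$ is a modular fixed point of $[\iota_q]_{3^n}$ if $\iota_q(z)\equiv z\pmod{3^n}$. One always has $v_0\le n-1$. *)

(* Defs.v *)
From HB Require Import structures.
From mathcomp Require Import all_boot all_order all_algebra.
From mathcomp Require Import mathcomp_extra boolp classical_sets functions.
From mathcomp Require Import constructive_ereal filter topology_structure.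
From mathcomp Require Import ring zify.

Set Implicit Arguments.
Unset Strict Implicit.
Unset Printing Implicit Defensive.
Import Order.TTheory GRing.Theory Num.Theory.

Local Open Scope ring_scope.
Local Open Scope classical_set_scope.

(* Z_3 as the inverse limit of the rings Z/3^k: [res x k] is the representative
   of x mod 3^k lying in [0, 3^k). The single condition below gives both the
   range of the residues and their compatibility. *)
Record Z3 := MkZ3 {
  res :> nat -> int;
  resE : forall k, (res k.+1 %% 3 ^+ k)%Z = res k }.

Lemma Z3_eqP (x y : Z3) : (forall k, x k = y k) -> x = y.
Proof.
case: x y => [x Hx] [y Hy] /= /funext exy; move: Hx Hy; rewrite exy => Hx Hy.
by congr MkZ3; exact: Prop_irrelevance.
Qed.

Lemma mod3_le (a : int) k m : (k <= m)%N ->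
  ((a %% 3 ^+ m)%Z %% 3 ^+ k)%Z = (a %% 3 ^+ k)%Z.
Proof.
move=> lekm; rewrite (_ : (a %% 3 ^+ m)%Z =
  - (a %/ 3 ^+ m)%Z * 3 ^+ (m - k) * 3 ^+ k + a) ?modzMDl //.
by rewrite -mulrA -exprD subnK // mulNr addrC.
Qed.

Lemma res_mod (x : Z3) k : (x k %% 3 ^+ k)%Z = x k.
Proof. by rewrite -[in RHS]resE -[in LHS]resE modz_mod. Qed.

Lemma res_le_mod (x : Z3) k m : (k <= m)%N -> (x m %% 3 ^+ k)%Z = x k.
Proof.
move=> lekm; rewrite -(subnK lekm); elim: (m - k)%N => [|d IH].
  exact: res_mod.
by rewrite addSn -IH -[in RHS]resE mod3_le ?leq_addl.
Qed.

Definition mkZ3 (f : nat -> int)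
    (Hf : forall k, (f k.+1 = f k %[mod 3 ^+ k])%Z) : Z3 :=
  @MkZ3 (fun k => (f k %% 3 ^+ k)%Z)
    (fun k => etrans (mod3_le (f k.+1) (leqnSn k)) (Hf k)).

Lemma res_step (x : Z3) k : (x k.+1 = x k %[mod 3 ^+ k])%Z.
Proof. by rewrite resE res_mod. Qed.

Lemma Z3_add_subproof (x y : Z3) k :
  (x k.+1 + y k.+1 = x k + y k %[mod 3 ^+ k])%Z.
Proof. by rewrite -modzDm !resE. Qed.

Lemma Z3_mul_subproof (x y : Z3) k :
  (x k.+1 * y k.+1 = x k * y k %[mod 3 ^+ k])%Z.
Proof. by rewrite -modzMm !resE. Qed.

Lemma Z3_opp_subproof (x : Z3) k : (- x k.+1 = - x k %[mod 3 ^+ k])%Z.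
Proof. by rewrite -modzNm resE. Qed.

Definition Z3_of_int (a : int) : Z3 := @mkZ3 (fun=> a) (fun=> erefl).
Definition Z3_add (x y : Z3) : Z3 := mkZ3 (Z3_add_subproof x y).
Definition Z3_mul (x y : Z3) : Z3 := mkZ3 (Z3_mul_subproof x y).
Definition Z3_opp (x : Z3) : Z3 := mkZ3 (Z3_opp_subproof x).

HB.instance Definition _ := gen_eqMixin Z3.
HB.instance Definition _ := gen_choiceMixin Z3.

Fact Z3_addA : associative Z3_add.
Proof. by move=> x y z; apply: Z3_eqP => k /=; rewrite modzDml modzDmr addrA. Qed.
Fact Z3_addC : commutative Z3_add.
Proof. by move=> x y; apply: Z3_eqP => k /=; rewrite addrC. Qed.
Fact Z3_add0 : left_id (Z3_of_int 0) Z3_add.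
Proof. by move=> x; apply: Z3_eqP => k /=; rewrite modzDml add0r res_mod. Qed.
Fact Z3_addN : left_inverse (Z3_of_int 0) Z3_opp Z3_add.
Proof. by move=> x; apply: Z3_eqP => k /=; rewrite modzDml addNr. Qed.
HB.instance Definition _ :=
  GRing.isZmodule.Build Z3 Z3_addA Z3_addC Z3_add0 Z3_addN.

Fact Z3_mulA : associative Z3_mul.
Proof. by move=> x y z; apply: Z3_eqP => k /=; rewrite modzMml modzMmr mulrA. Qed.
Fact Z3_mulC : commutative Z3_mul.
Proof. by move=> x y; apply: Z3_eqP => k /=; rewrite mulrC. Qed.
Fact Z3_mul1 : left_id (Z3_of_int 1) Z3_mul.
Proof. by move=> x; apply: Z3_eqP => k /=; rewrite modzMml mul1r res_mod. Qed.
Fact Z3_mulD : left_distributive Z3_mul Z3_add.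
Proof.
by move=> x y z; apply: Z3_eqP => k /=; rewrite modzMml modzDm mulrDl.
Qed.
Fact Z3_oner_neq0 : Z3_of_int 1 != 0.
Proof. by apply/eqP => /(congr1 (fun x : Z3 => x 1%N)). Qed.
HB.instance Definition _ := GRing.Zmodule_isComNzRing.Build Z3
  Z3_mulA Z3_mulC Z3_mul1 Z3_mulD Z3_oner_neq0.

Lemma res0 k : (0 : Z3) k = 0. Proof. exact: mod0z. Qed.
Lemma res1 k : (1 : Z3) k = (1 %% 3 ^+ k)%Z. Proof. by []. Qed.
Lemma resD (x y : Z3) k : (x + y) k = ((x k + y k) %% 3 ^+ k)%Z.
Proof. by []. Qed.
Lemma resN (x : Z3) k : (- x) k = ((- x k) %% 3 ^+ k)%Z.
Proof. by []. Qed.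
Lemma resM (x y : Z3) k : (x * y) k = ((x k * y k) %% 3 ^+ k)%Z.
Proof. by []. Qed.

Lemma resB (x y : Z3) k : (x - y) k = ((x k - y k) %% 3 ^+ k)%Z.
Proof. by rewrite resD resN modzDmr. Qed.

Lemma res_nat n k : (n%:R : Z3) k = (n%:Z %% 3 ^+ k)%Z.
Proof.
elim: n => [|n IH]; first by rewrite mulr0n res0 mod0z.
by rewrite -natr1 resD IH res1 modzDm intS addrC.
Qed.

Lemma resX (x : Z3) n k : (x ^+ n) k = (x k ^+ n %% 3 ^+ k)%Z.
Proof.
elim: n => [|n IH]; first exact: res1.
by rewrite !exprS resM IH modzMmr.
Qed.

Lemma res_sum n (F : nat -> Z3) k :
  (\sum_(i < n) F i) k = ((\sum_(i < n) F i k) %% 3 ^+ k)%Z.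
Proof.
elim: n => [|n IH]; first by rewrite !big_ord0 res0 mod0z.
by rewrite !big_ord_recr resD IH /= modzDml.
Qed.

(* a Z_3 *)
Definition multiples (a : Z3) : set Z3 := [set a * y | y in [set: Z3]].

(* z + a Z_3 *)
Definition coset (z a : Z3) : set Z3 := [set z + a * y | y in [set: Z3]].

(* x = y mod a Z_3 *)
Definition eqmod (a x y : Z3) : Prop := multiples a (x - y).

(* U^(m) = 1 + 3^m Z_3 *)
Definition U (m : nat) : set Z3 := coset 1 (3%:R ^+ m).

Lemma cosetE z a x : coset z a x <-> eqmod a x z.
Proof.
split=> -[y _ e]; exists y => //; first by rewrite -e addrC addKr.
by rewrite e addrC subrK.
Qed.

Lemma res_eq0_le (x : Z3) m k : (k <= m)%N -> x m = 0 -> x k = 0.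
Proof.
by move=> lekm e; rewrite -(res_le_mod x lekm) e mod0z.
Qed.

Lemma multiples3P m (x : Z3) : multiples (3%:R ^+ m) x <-> x m = 0.
Proof.
split=> [[y _ <-]|xm].
  by rewrite resM resX !res_nat modzXm modzMml modzMr.
have dv k : (3 ^+ m %| x (k + m)%N)%Z.
  by apply/dvdz_mod0P; rewrite res_le_mod ?leq_addl.
have cp k : ((x (k.+1 + m)%N %/ 3 ^+ m)%Z = (x (k + m)%N %/ 3 ^+ m)%Z
    %[mod 3 ^+ k])%Z.
  apply/eqP; rewrite eqz_mod_dvd -(@dvdz_mul2r (3 ^+ m)) ?expf_neq0 //.
  rewrite -exprD mulrBl !divzK ?dv // -eqz_mod_dvd.
  by rewrite addSn res_step.
exists (mkZ3 cp) => //; apply: Z3_eqP => k.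
rewrite resM resX res_nat modzXm /= modzMml modzMmr mulrC divzK ?dv //.
by rewrite res_le_mod ?leq_addr.
Qed.

Lemma eqmod3P m (x y : Z3) : eqmod (3%:R ^+ m) x y <-> x m = y m.
Proof.
rewrite /eqmod multiples3P resB; split=> [/dvdz_mod0P|->].
  by rewrite -eqz_mod_dvd => /eqP; rewrite !res_mod.
by rewrite subrr mod0z.
Qed.

Lemma coset3P m (x z : Z3) : coset z (3%:R ^+ m) x <-> x m = z m.
Proof. by rewrite cosetE eqmod3P. Qed.

(* The 3-adic topology: the cosets x + 3^m Z_3 form a basis of neighbourhoods
   of x. *)
Definition Z3_nbhs (x : Z3) : set_system Z3 :=
  [set A | exists m, coset x (3%:R ^+ m) `<=` A].
HB.instance Definition _ := hasNbhs.Build Z3 Z3_nbhs.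

Lemma res_le (x y : Z3) m k : (k <= m)%N -> x m = y m -> x k = y k.
Proof.
by move=> lekm e; rewrite -(res_le_mod x lekm) e res_le_mod.
Qed.

Fact Z3_nbhs_filter (x : Z3) : ProperFilter (nbhs x).
Proof.
split; first by case=> m /(_ x); apply; apply/coset3P.
split; first by exists 0%N.
- move=> A B [m Am] [k Bk]; exists (maxn m k) => y /coset3P e; split.
    by apply: Am; apply/coset3P; apply: res_le e; rewrite leq_maxl.
  by apply: Bk; apply/coset3P; apply: res_le e; rewrite leq_maxr.
- by move=> A B AB [m Am]; exists m => y /Am/AB.
Qed.
Fact Z3_nbhs_singleton (x : Z3) (A : set Z3) : nbhs x A -> A x.
Proof. by case=> m; apply; apply/coset3P. Qed.
Fact Z3_nbhs_nbhs (x : Z3) (A : set Z3) : nbhs x A -> nbhs x (nbhs^~ A).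
Proof.
case=> m Am; exists m => y /coset3P e; exists m => z /coset3P e'.
by apply: Am; apply/coset3P; rewrite e'.
Qed.
HB.instance Definition _ := Nbhs_isNbhsTopological.Build Z3
  Z3_nbhs_filter Z3_nbhs_singleton Z3_nbhs_nbhs.

Lemma Z3_continuousP (f : Z3 -> Z3) :
  continuous f <->
  forall (x : Z3) m, exists k, forall y : Z3, y k = x k -> f y m = f x m.
Proof.
split=> [cf x m|cf x A [m Am]].
  have [|k fk] := cf x (coset (f x) (3%:R ^+ m)); first by exists m.
  by exists k => y /coset3P/fk /= /coset3P.
have [k fk] := cf x m; exists k => y /coset3P/fk e.
by apply: Am; apply/coset3P.
Qed.

(* The additive 3-adic valuation, with values in Z + {-oo, +oo}: the largest m
   such that x is in 3^m Z_3, and +oo if there is none (i.e. x = 0). *)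
Definition v3 (x : Z3) : \bar int :=
  if pselect (exists m, `[< ~ multiples (3%:R ^+ m.+1) x >]) is left h
  then (ex_minn h)%:Z%:E else +oo%E.
Arguments v3 x%_R.

Lemma v3_0 : v3 0 = +oo%E.
Proof.
rewrite /v3; case: pselect => // h; exfalso; case: h => m /asboolP; apply.
by apply/multiples3P; rewrite res0.
Qed.

Lemma v3P (x : Z3) (m : nat) : v3 x = m%:Z%:E <->
  multiples (3%:R ^+ m) x /\ ~ multiples (3%:R ^+ m.+1) x.
Proof.
rewrite !multiples3P /v3; case: pselect => [h|h].
  case: ex_minnP => k /asboolP; rewrite multiples3P => xk kmin.
  split=> [[<-]|[xm xm1]].
    split=> //; case: k kmin {xk} => [|k] kmin.
      by rewrite -res_mod expr0 modz1.
    case: (pselect (multiples (3%:R ^+ k.+1) x)) => [/multiples3P //|nk].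
    by have := kmin _ (asboolT nk); rewrite ltnn.
  congr (_%:Z%:E); apply/eqP; rewrite eqn_leq kmin /=; last first.
    by apply/asboolP; rewrite multiples3P.
  by rewrite leqNgt; apply/negP => /res_eq0_le /(_ xm).
by split=> // -[_ xm1]; case: h; exists m; apply/asboolP; rewrite multiples3P.
Qed.

Definition interpolates_qint (q : Z3) (f : Z3 -> Z3) : Prop :=
  forall k : nat, f k%:R = \sum_(i < k) q ^+ i.

(* iota_q is the unique continuous function interpolating the q-integers;
   existence and uniqueness for q in U^(1) are shown below. *)
Definition iota_q (q : Z3) : Z3 -> Z3 :=
  xget (idfun : Z3 -> Z3) [set f : Z3 -> Z3 | continuous f /\ interpolates_qint q f].

Lemma res_ge0 (x : Z3) k : 0 <= x k.
Proof. by rewrite -res_mod modz_ge0 // expf_neq0. Qed.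

Lemma natr_res (x : Z3) k : ((`|x k|%N)%:R : Z3) k = x k.
Proof. by rewrite res_nat gez0_abs ?res_ge0 // res_mod. Qed.

Lemma qint_add (q : Z3) m n :
  \sum_(i < m + n) q ^+ i = \sum_(i < m) q ^+ i + q ^+ m * \sum_(i < n) q ^+ i.
Proof.
rewrite big_split_ord /= mulr_sumr; congr (_ + _).
by apply: eq_bigr => i _; rewrite exprD.
Qed.

Lemma qint3 (q : Z3) k : U 1 q -> (\sum_(i < 3 ^ k) q ^+ i) k = 0.
Proof.
case=> y _; rewrite expr1 => qE; apply/multiples3P.
suff [s [_]] : exists s, q ^+ (3 ^ k) = 1 + 3%:R * s /\
    multiples (3%:R ^+ k) (\sum_(i < 3 ^ k) q ^+ i) by [].
elim: k => [|k [s [qs [w _ wE]]]].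
  exists y; split; first by rewrite expr1 qE.
  by exists (\sum_(i < 3 ^ 0) q ^+ i); rewrite ?mul1r.
exists (3%:R * s + 9%:R * s ^+ 2 + 9%:R * s ^+ 3); split.
  by rewrite expnS mulnC exprM qs; ring.
exists (w * (1 + 3%:R * s + 3%:R * s ^+ 2)) => //.
have -> : (3 ^ k.+1 = 3 ^ k + (3 ^ k + 3 ^ k))%N by rewrite expnS; lia.
by rewrite !qint_add -wE qs exprS; ring.
Qed.

Lemma qint_mod (q : Z3) m n k : U 1 q -> (m = n %[mod 3 ^ k])%N ->
  (\sum_(i < m) q ^+ i) k = (\sum_(i < n) q ^+ i) k.
Proof.
move=> U1q; have qmod j : (\sum_(i < j) q ^+ i) k =
    (\sum_(i < j %% 3 ^ k) q ^+ i) k.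
  rewrite [in LHS](divn_eq j (3 ^ k)); elim: (j %/ 3 ^ k)%N => // d IH.
  rewrite mulSn -addnA addnC qint_add resD resM qint3 // mulr0 mod0z addr0.
  by rewrite res_mod.
by move=> mn; rewrite qmod mn -qmod.
Qed.

Lemma qint_compat (q : Z3) : U 1 q -> forall (z : Z3) k,
  ((\sum_(i < `|z k.+1|%N) q ^+ i) k.+1 = (\sum_(i < `|z k|%N) q ^+ i) k
    %[mod 3 ^+ k])%Z.
Proof.
move=> U1q z k; rewrite res_mod resE (@qint_mod q _ `|z k|%N) //.
have : (`|z k.+1|%N%:Z = `|z k|%N %[mod 3 ^+ k])%Z.
  by rewrite !gez0_abs ?res_ge0 // resE res_mod.
by rewrite -[3 ^+ k](@natrX int 3 k) natz !modz_nat => -[].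
Qed.

Lemma iota_q_exists (q : Z3) : U 1 q ->
  exists f : Z3 -> Z3, continuous f /\ interpolates_qint q f.
Proof.
move=> U1q; exists (fun z => mkZ3 (qint_compat U1q z)); split.
  by apply/Z3_continuousP => x m; exists m => y /= ->.
move=> n; apply: Z3_eqP => k /=; rewrite res_mod; apply: qint_mod => //.
by rewrite res_nat -[3 ^+ k](@natrX int 3 k) natz modz_nat modn_mod.
Qed.

Lemma iota_qP (q : Z3) : U 1 q ->
  continuous (iota_q q) /\ interpolates_qint q (iota_q q).
Proof. by move=> /iota_q_exists [f fP]; rewrite /iota_q; case: xgetP => // /(_ f). Qed.

Lemma iota_q_unique (q : Z3) (f : Z3 -> Z3) : U 1 q ->
  continuous f -> interpolates_qint q f -> f = iota_q q.
Proof.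
move=> /iota_qP [/Z3_continuousP ci iq] /Z3_continuousP cf fq.
apply/funext => z; apply: Z3_eqP => m.
have [k fk] := cf z m; have [l il] := ci z m.
have e : ((`|z (maxn k l)|%N)%:R : Z3) (maxn k l) = z (maxn k l).
  exact: natr_res.
rewrite -(fk _ (res_le (leq_maxl k l) e)) -(il _ (res_le (leq_maxr k l) e)).
by rewrite fq iq.
Qed.

Definition modular_fixed_point (q : Z3) (n : nat) : set Z3 :=
  [set z | eqmod (3%:R ^+ n) (iota_q q z) z].

(* Main.v *)
(* Write q = 1 + 3u, so that q^3 = 1 + 9w with w prime to 3. The binomial series of
   iota_{q^3}(y) converges so fast that iota_{q^3}(y) / y is a polynomial in y with
   3-integral coefficients, congruent to 1 + (9w/2)(y - 1) modulo 27. Since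
   iota_q(3y + r) is an affine function of iota_{q^3}(y), this yields
   iota_q(z) - z = 3 (z - r) h_r(z) for z = r mod 3, r = 0 or 1, where
   |h_r(x) - h_r(y)| = |x - y|, and h_r vanishes modulo 3 for r = 0 if q = 7 mod 9 and
   for r = 1 if q = 4 mod 9; for the other r it is a unit. By Hensel's argument this
   h_r has a zero s = r mod 3, so z is a modular fixed point if and only if
   3^(n-1) divides z (z - 1) (z - s). The fixed points are then read off from the
   valuation of s (or of s - 1, exchanging 0 and 1 by z |-> 1 - z). *)
Require Import Defs.
From HB Require Import structures.
From mathcomp Require Import all_boot all_order all_algebra.
From mathcomp Require Import mathcomp_extra boolp classical_sets functions.
From mathcomp Require Import constructive_ereal filter topology_structure.
From mathcomp Require Import ring zify.

Set Implicit Arguments.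
Unset Strict Implicit.
Unset Printing Implicit Defensive.
Import Order.TTheory GRing.Theory Num.Theory.

Local Open Scope ring_scope.
Local Open Scope classical_set_scope.

(** * Powers of 3 in integers and factorials *)

Lemma Gauss_dvdz_exp3 (k : nat) (a x : int) :
  ~~ (3 %| a)%Z -> (3 ^+ k %| a * x)%Z = (3 ^+ k %| x)%Z.
Proof.
move=> a3; apply: Gauss_dvdzr; rewrite /coprimez /gcdz abszX.
by rewrite eqz_nat -/(coprime _ _) coprimeXl // prime_coprime.
Qed.

Lemma dvd3M (a b : int) :
  (3 %| a * b)%Z = (3 %| a)%Z || (3 %| b)%Z.
Proof. by rewrite !dvdzE abszM Euclid_dvdM. Qed.

(** A weak form of Legendre's formula. It bounds the powers of 3 in the denominators of the binomial
    series. *)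
Lemma leq_logn3_fact (j : nat) : (2 * logn 3 j`! <= j)%N.
Proof.
elim/ltn_ind: j => j IH; case: (ltnP j 3) => [|j3]; first by case: j {IH} => [|[|[]]].
have [d [r [jE r3 d0]]] : exists d r, [/\ j = (d * 3 + r)%N, (r < 3)%N & (0 < d)%N].
  by exists (j %/ 3)%N, (j %% 3)%N; split; lia.
rewrite {}jE in j3 IH *.
(* Only the multiples of 3 among the factors of [(3d + r)!] contribute, and their product is
   [3^d d!]. *)
suff -> : logn 3 (d * 3 + r)`! = (d + logn 3 d`!)%N.
  by have := IH d; lia.
have aux k i : (0 < i < 3)%N -> logn 3 (k * 3 + i) = 0%N.
  by move=> i3; apply/eqP; rewrite lognE; case: ifP => // /and3P[_ _]; lia.
have aux1 k : logn 3 (k * 3).+1 = 0%N by have := aux k 1 isT; rewrite addn1.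
have aux2 k : logn 3 (k * 3).+2 = 0%N by have := aux k 2 isT; rewrite addn2.
have step : logn 3 (d * 3)`! = (d + logn 3 d`!)%N.
  elim: d {IH j3 d0} => // d IH; rewrite mulSn !addSn add0n !factS.
  rewrite !lognM ?muln_gt0 ?fact_gt0 // IH.
  have -> : (d * 3).+3 = (d.+1 * 3)%N by lia.
  rewrite aux1 aux2 //.
  by rewrite lognM // (_ : logn 3 3 = 1%N) //; lia.
case: r r3 {IH j3} => [|[|[]]] // _; rewrite ?addn0 // ?addn1 ?addn2 !factS.
  by rewrite lognM ?fact_gt0 // aux1.
by rewrite !lognM ?muln_gt0 ?fact_gt0 // aux1 aux2.
Qed.

(** * Binomial expansion of q-integers *)

(** This is the expansion of [((1 + x)^y - 1) / x] with the division carried out, proved by Pascal's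
    rule. The range [N] does not depend on [y], because the terms with [j >= y] vanish. *)
Lemma qint_binomial (R : comNzRingType) (x : R) (N y : nat) : (y <= N)%N ->
  \sum_(i < y) (1 + x) ^+ i = \sum_(j < N) x ^+ j *+ 'C(y, j.+1).
Proof.
elim: y => [|y IH] lyN; first by rewrite big_ord0 big1 // => i _; rewrite bin0n mulr0n.
rewrite big_ord_recr /= IH ?(ltnW lyN) //.
rewrite [RHS](eq_bigr (fun j : 'I_N => x ^+ j *+ 'C(y, j.+1) + x ^+ j *+ 'C(y, j))); last first.
  by move=> i _; rewrite binS mulrnDr.
rewrite big_split /=; congr (_ + _).
rewrite exprDn (big_ord_widen _ (fun j => 1 ^+ (y - j) * x ^+ j *+ 'C(y, j)) lyN).
rewrite [RHS](bigID (fun j : 'I_N => (j < y.+1)%N)) /= [X in _ = _ + X]big1 ?addr0.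
  by apply: eq_bigr => i _; rewrite expr1n mul1r.
by move=> i; rewrite -leqNgt => yi; rewrite bin_small.
Qed.

(* For a natural number [y], [y * pffact j y] is the falling factorial
   [y (y - 1) ... (y - j)]. *)
Definition pffact (j : nat) (y : int) : int := \prod_(i < j) (y - i.+1%:Z).

Lemma pffactS (j : nat) (y : int) : pffact j.+1 y = pffact j y * (y - j.+1%:Z).
Proof. exact: big_ord_recr. Qed.

Lemma pffact_bin (j y : nat) :
  (j.+1`!)%:Z * ('C(y, j.+1))%:Z = y%:Z * pffact j y.
Proof.
elim: j => [|j IH]; first by rewrite /pffact big_ord0 bin1 mulr1 [(_`!)%:Z](_ : _ = 1) ?mul1r.
rewrite pffactS mulrA -IH factS.
case: (leqP j.+1 y) => yj.
  have e : j.+2%:Z * 'C(y, j.+2)%:Z = (y%:Z - j.+1%:Z) * 'C(y, j.+1)%:Z.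
    by rewrite -PoszM mul_bin_left PoszM subzn.
  rewrite [(j.+2 * _)%:Z]PoszM.
  transitivity ((j.+1`!)%:Z * (j.+2%:Z * 'C(y, j.+2)%:Z)); first by ring.
  by rewrite e; ring.
by rewrite !(@bin_small y) ?ltnS // ?mulr0 ?mul0r // ltnW.
Qed.

Lemma pffact_sub (j : nat) (x y : int) : (x - y %| pffact j x - pffact j y)%Z.
Proof.
elim: j => [|j IH]; first by rewrite /pffact !big_ord0 subrr dvdz0.
rewrite !pffactS.
rewrite (_ : _ - _ = (pffact j x - pffact j y) * (x - j.+1%:Z) + pffact j y * (x - y)).
  by apply: rpredD; [exact: dvdz_mulr | exact: dvdz_mull].
by ring.
Qed.

(** The prime-to-3 part of [(j+1)!] divides that of [N!]. Its 3-part times 27 divides [9^j], as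
    [3 + (j+1)/2 <= 2j] with the half rounded down; equality holds at [j = 2]. Of the factor 27, 9
    is taken out of the series and 3 makes the higher terms negligible. *)
Lemma fact_dvd_exp9 (N j : nat) : (2 <= j < N)%N ->
  exists d : int, (N`!`_(3^')%N)%:Z * 9 ^+ j = 27 * d * (j.+1`!)%:Z.
Proof.
move=> /andP[j2 jN]; suff /dvdnP[d dE] : (27 * j.+1`! %| N`!`_(3^')%N * 9 ^ j)%N.
  exists d%:Z; have := congr1 Posz dE.
  rewrite PoszM [(d * _)%:Z]PoszM [(27 * _)%:Z]PoszM -[(9 ^ j)%N%:Z]natz natrX => ->.
  by ring.
rewrite -(partnC 3%N (fact_gt0 j.+1)) [X in (_ %| X)%N]mulnC mulnA; apply: dvdn_mul.
  rewrite p_part -(expnD 3 3)%N (_ : 9 ^ j = (3 ^ 2) ^ j)%N //.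
  by rewrite -expnM; apply: dvdn_exp2l; have := leq_logn3_fact j.+1; lia.
by apply: partn_dvd; rewrite ?fact_gt0 // -(bin_fact jN) dvdn_mull // dvdn_mulr.
Qed.

(* [T] clears the prime-to-3 denominators of the binomial series of
   [((1 + 9 w) ^ y - 1) / (9 w)]; the remaining powers of 3 in [j!] are absorbed by
   [9 ^ (j - 1)], so that [p] is a polynomial with integral coefficients. *)
Lemma qint9_poly (N : nat) (w : int) : (2 <= N)%N -> exists (T : int) (p : int -> int),
  [/\ ~~ (3 %| T)%Z,
      forall y : nat, (y <= N)%N ->
        T * \sum_(i < y) (1 + 9 * w) ^+ i = y%:Z * (T + 9 * p y)
    & forall x y, exists c, 2 * (p x - p y) = (x - y) * (T * w + 3 * c)].
Proof.
case: N => [|[|N]] // _; pose T : int := (N.+2`!`_(3^')%N)%:Z.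
have T3 : ~~ (3 %| T)%Z.
  by rewrite dvdzE /T /= -p'natE // part_pnat.
(* [T2] is [T / 2], which absorbs the denominator of ['C(y, 2) = y (y - 1) / 2]. *)
have /dvdzP[T2 T2E] : (2 %| T)%Z.
  rewrite dvdzE /T /= -[X in (X %| _)%N](@part_pnat_id (3^')%N) ?p'natE //.
  by apply: partn_dvd; rewrite ?fact_gt0 ?dvdn_fact.
have /fin_all_exists[d dE] (j : 'I_N) : exists d : int,
    T * 9 ^+ j.+2 = 27 * d * (j.+3`!)%:Z.
  by apply: fact_dvd_exp9; rewrite !ltnS /=.
(* The linear part comes from the term [j = 1] of the series, the sum from the terms [j >= 2]. The
   factor 2 in the last conclusion turns [T2] back into [T]. *)
exists T, (fun y => w * T2 * (y - 1) + 3 * \sum_(j < N) d j * w ^+ j.+2 * pffact j.+2 y).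
split=> // [y yN|x y].
  rewrite (qint_binomial _ yN) 2!big_ord_recl /= expr0 bin1.
  have e (j : nat) : T * ((9 * w) ^+ j *+ 'C(y, j.+1)) = T * 9 ^+ j * w ^+ j * ('C(y, j.+1))%:Z.
    by rewrite exprMn -mulr_natr natz; ring.
  have e2 : T * ((9 * w) ^+ 1 *+ 'C(y, 2)) = y%:Z * (9 * (w * T2 * (y%:Z - 1))).
    rewrite e T2E.
    have := pffact_bin 1 y; rewrite /pffact big_ord1 => /= h.
    transitivity (T2 * 9 * w * (2 * 'C(y, 2)%:Z)); first by ring.
    by rewrite (_ : 2 * 'C(y, 2)%:Z = (2`!)%:Z * 'C(y, 2)%:Z) // h; ring.
  rewrite 2!mulrDr e2; set S := \sum_(j < N) d j * _ * _.
  rewrite [RHS](_ : _ = T * 1 *+ y + (y%:Z * (9 * (w * T2 * (y%:Z - 1))) + 27 * y%:Z * S)).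
    congr (_ + (_ + _)); first by rewrite mulrnAr.
    rewrite !mulr_sumr; apply: eq_bigr => j _.
    rewrite /bump /= !add1n e dE.
    transitivity (27 * d j * w ^+ j.+2 * ((j.+3)`!%:Z * ('C(y, j.+3))%:Z)); first by ring.
    by rewrite pffact_bin; ring.
  by rewrite -mulr_natr natz; ring.
have /dvdzP[c cE] : (x - y %| \sum_(j < N) d j * w ^+ j.+2 * pffact j.+2 x -
    \sum_(j < N) d j * w ^+ j.+2 * pffact j.+2 y)%Z.
  rewrite -sumrB; apply: rpred_sum => j _; rewrite -mulrBr.
  by apply/dvdz_mull/pffact_sub.
exists (2 * c); rewrite T2E.
rewrite [X in 2 * X](_ : _ = w * T2 * (x - y) + 3 * (c * (x - y))); first by ring.
by rewrite -cE; ring.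
Qed.

(** * Hensel's argument over the integers *)

(** The variable is [y] in [z = 3y + r], so the difference quotient is 3 times a unit and each
    correction of [y] by a multiple of [3^n] gains one power of 3 in [h y]. Roots modulo powers of 3
    replace the 3-adic zero, so that all values stay in [int]. *)
Lemma hensel3 (h : int -> int) (k : int) (n : nat) :
  ~~ (3 %| k)%Z -> (3 %| h 0)%Z ->
  (forall x y, exists c, h x - h y = 3 * (x - y) * (k + 3 * c)) ->
  exists y, (3 ^+ n.+1 %| h y)%Z.
Proof.
move=> k3 h0 hB; elim: n => [|n [y /dvdzP[c cE]]]; first by exists 0.
(* Newton step: since [k * k = 1] modulo 3, [k] serves as its own inverse. *)
exists (y - 3 ^+ n * (c * k)); have [b bE] := hB (y - 3 ^+ n * (c * k)) y.
have /dvdzP[a aE] : (3 %| 1 - k * k)%Z.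
  have [i [kE|kE]] : exists i, k = 3 * i + 1 \/ k = 3 * i - 1.
    by exists ((k + 1) %/ 3)%Z; lia.
  - by apply/dvdzP; exists (- i * (3 * i + 2)); rewrite kE; ring.
  - by apply/dvdzP; exists (- i * (3 * i - 2)); rewrite kE; ring.
rewrite -[h _](subrK (h y)) bE cE.
apply/dvdzP; exists (c * a - c * k * b).
rewrite !exprS; transitivity (3 ^+ n * 3 * c * (1 - k * k - 3 * (k * b))); first by ring.
by rewrite aE; ring.
Qed.

(** With [t] a root of [2 h] modulo [3^(m+1)] and [s = 3t], [2 h y] is [3y - s] times the unit
    [k + 3c], up to a multiple of [3^(m+1)]. *)
Lemma root_class (m : nat) (h : int -> int) (k : int) :
  ~~ (3 %| k)%Z -> (3 %| h 0)%Z ->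
  (forall x y, exists c, 2 * (h x - h y) = 3 * (x - y) * (k + 3 * c)) ->
  exists2 s : int, (3 %| s)%Z &
    forall y : int, (3 ^+ m %| 3 * y * h y)%Z = (3 ^+ m %| 3 * y * (3 * y - s))%Z.
Proof.
move=> k3 h0 hB; have [|||t /dvdzP[a aE]] := @hensel3 (fun y => 2 * h y) k m.
- by [].
- by rewrite dvdz_mull.
- by move=> x y; have [c cE] := hB x y; exists c; rewrite -mulrBr.
exists (3 * t) => [|y]; first by rewrite dvdz_mulr.
have [c cE] := hB y t.
rewrite -(@Gauss_dvdz_exp3 m 2) // -[RHS](@Gauss_dvdz_exp3 m (k + 3 * c)); last by lia.
have -> : 2 * (3 * y * h y) = (k + 3 * c) * (3 * y * (3 * y - 3 * t)) + 3 * y * a * 3 * 3 ^+ m.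
  transitivity (3 * y * (2 * (h y - h t)) + 3 * y * (2 * h t)); first by ring.
  by rewrite cE aE exprS; ring.
by apply: rpredDr; rewrite dvdz_mull.
Qed.

(** * The defect [iota_q(k) - k] in each residue class modulo 3 *)

Lemma qint_triple (R : comNzRingType) (x : R) (y : nat) :
  \sum_(i < y * 3) x ^+ i = (1 + x + x ^+ 2) * \sum_(i < y) (x ^+ 3) ^+ i.
Proof.
elim: y => [|y IH]; first by rewrite !big_ord0 mulr0.
rewrite mulSn !addSn add0n !big_ord_recr /= IH.
by rewrite -exprM mulnC !exprS; ring.
Qed.

Lemma qint_mod3 (a : int) (y : nat) : (3 %| \sum_(i < y) (1 + 3 * a) ^+ i - y%:Z)%Z.
Proof.
elim: y => [|y IH]; first by rewrite big_ord0.
have /dvdzP[b bE] : (3 %| (1 + 3 * a) ^+ y - 1)%Z.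
  by rewrite -[X in _ - X](expr1n _ y) subrXX dvdz_mulr //; apply/dvdzP; exists a; ring.
rewrite big_ord_recr /= -[y.+1]addn1 PoszD.
move: (\sum_(i < y) _) ((1 + 3 * a) ^+ y) IH bE => S X; lia.
Qed.

(** For [q = 1 + 3u], the constants come from [1 + q + q^2 = 3 (1 + 3 c0)] and
    [q (1 + q + q^2) = 3 (1 + 3 c1)], the slopes of [iota_q(3y)] and [iota_q(3y + 1)] as affine
    functions of [iota_{q^3}(y)]. In the class of 2 the defect is [3u] modulo 9, which excludes
    fixed points. *)
Lemma defect_classes (N : nat) (u : int) : (2 <= N)%N -> ~~ (3 %| u)%Z ->
  exists (T : int) (p : int -> int),
  let c0 := u + u ^+ 2 in
  let c1 := 2 * u + 4 * u ^+ 2 + 3 * u ^+ 3 in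
  let defect k := \sum_(i < k) (1 + 3 * u) ^+ i - k%:Z in
  let h c y := T * c + 3 * (1 + 3 * c) * p y in
  [/\ ~~ (3 %| T)%Z,
      forall y : nat, (y <= N)%N ->
        T * defect (y * 3)%N = 3 * (3 * y%:Z * h c0 y) /\
        T * defect (y * 3).+1 = 3 * (3 * y%:Z * h c1 y),
      forall y : nat, ~~ (9 %| defect (y * 3).+2)%Z
    & exists2 k : int, ~~ (3 %| k)%Z &
        forall c x y, exists b, 2 * (h c x - h c y) = 3 * (x - y) * (k + 3 * b)].
Proof.
move=> N2 u3; pose w := u + 3 * u ^+ 2 + 3 * u ^+ 3.
have wE : (1 + 3 * u) ^+ 3 = 1 + 9 * w by rewrite /w; ring.
have [T [p [T3 Tp pB]]] := qint9_poly w N2.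
exists T, p => c0 c1 defect h; split=> //.
- move=> y yN; have := Tp y yN; rewrite /defect !big_ord_recr /= qint_triple wE.
  set S := \sum_(i < y) _; rewrite -[(y * 3).+1]addn1 PoszD PoszM => SE; split.
    transitivity (3 * ((1 + 3 * c0) * (T * S) - T * y)); first by rewrite /c0; ring.
    by rewrite SE /h /c0; ring.
  have -> : (1 + 3 * u) ^+ (y * 3) = 1 + 3 * u * ((1 + (1 + 3 * u) + (1 + 3 * u) ^+ 2) * S).
    have := subrX1 (1 + 3 * u) (y * 3); rewrite qint_triple wE -/S => e.
    by rewrite -[LHS](subrK 1) e; ring.
  transitivity (3 * ((1 + 3 * c1) * (T * S) - T * y)); first by rewrite /c1; ring.
  by rewrite SE /h /c1; ring.
- move=> y; rewrite /defect !big_ord_recr /= qint_triple wE.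
  have := qint_mod3 (3 * w) y; rewrite (_ : 3 * (3 * w) = 9 * w); last by ring.
  set S := \sum_(i < y) _ => /dvdzP[a aE].
  have /dvdzP[b bE] : (9 %| (1 + 3 * u) ^+ (y * 3) - 1)%Z.
    rewrite mulnC exprM wE -[X in _ - X](expr1n _ y) subrXX dvdz_mulr //.
    by apply/dvdzP; exists w; ring.
  have bE' : (1 + 3 * u) ^+ (y * 3) = 1 + b * 9 by rewrite -bE; ring.
  have SE : S = y%:Z + a * 3 by rewrite -aE; ring.
  rewrite [_ ^+ (y * 3).+1]exprS bE' SE; apply/negP => /dvdzP[d dE].
  (* The defect equals [3u + 9e]. *)
  pose e := (u + u ^+ 2) * y%:Z + a * (1 + 3 * u + 3 * u ^+ 2) + 2 * b + 3 * u * b.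
  have : 3 * u = d * 9 - 9 * e.
    by rewrite -dE (_ : (y * 3).+2%:Z = y%:Z * 3 + 2) /e; [ring | lia].
  by lia.
exists (T * w) => [|c x y].
  rewrite dvd3M negb_or T3 /w (_ : _ + _ = u + 3 * (u ^+ 2 + u ^+ 3)); last by ring.
  by lia.
have [b bE] := pB x y; exists (b + c * (T * w + 3 * b)).
transitivity (3 * (1 + 3 * c) * (2 * (p x - p y))); first by rewrite /h; ring.
by rewrite bE; ring.
Qed.

Lemma dvdz_exp3_decomp (m : nat) (T d x : int) : ~~ (3 %| T)%Z -> T * d = 3 * x ->
  (3 ^+ m.+1 %| d)%Z = (3 ^+ m %| x)%Z.
Proof.
move=> T3 e; rewrite -(Gauss_dvdz_exp3 _ d T3) e exprS dvdz_mul2l //.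
Qed.

(** The two cases are [q = 7] and [q = 4] modulo 9. In the class of [r], [root_class] supplies the
    factor [k - s]; in the other class among 0 and 1, [h] is a unit. The factors of the cubic that
    are units in a given class are then inserted freely, and in the class of 2 neither side is
    divisible. *)
Lemma defect_root (m : nat) (u : int) (r : int) : (0 < m)%N ->
  (r = 0 /\ (3 %| u - 2)%Z) \/ (r = 1 /\ (3 %| u - 1)%Z) ->
  exists2 s : int, (3 %| s - r)%Z & forall k : nat, (k <= 3 ^ m.+1)%N ->
    (3 ^+ m.+1 %| \sum_(i < k) (1 + 3 * u) ^+ i - k%:Z)%Z =
    (3 ^+ m %| k%:Z * (k%:Z - 1) * (k%:Z - s))%Z.
Proof.
move=> m0 ru; have u3 : ~~ (3 %| u)%Z by lia.
have N2 : (2 <= 3 ^ m.+1)%N by rewrite (leq_trans _ (leq_pexp2l _ (ltn0Sn m))).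
have [T [p /= [T3 D01 D2 [kappa kappa3 hB]]]] := defect_classes N2 u3.
pose c0 := u + u ^+ 2; pose c1 := 2 * u + 4 * u ^+ 2 + 3 * u ^+ 3.
pose h (c y : int) := T * c + 3 * (1 + 3 * c) * p y.
pose defect (k : nat) := \sum_(i < k) (1 + 3 * u) ^+ i - k%:Z.
have D0 y : (y <= 3 ^ m.+1)%N ->
    (3 ^+ m.+1 %| defect (y * 3)%N)%Z = (3 ^+ m %| 3 * y%:Z * h c0 y)%Z.
  by move=> /D01[/(dvdz_exp3_decomp m T3)].
have D1 y : (y <= 3 ^ m.+1)%N ->
    (3 ^+ m.+1 %| defect (y * 3).+1)%Z = (3 ^+ m %| 3 * y%:Z * h c1 y)%Z.
  by move=> /D01[_ /(dvdz_exp3_decomp m T3)].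
have kdec (k : nat) : exists y, k = (y * 3)%N \/ k = (y * 3).+1 \/ k = (y * 3).+2.
  by exists (k %/ 3)%N; lia.
have y3 (y : nat) : (y * 3)%N%:Z = 3 * y%:Z by lia.
have y31 (y : nat) : (y * 3).+1%:Z = 3 * y%:Z + 1 by lia.
have m9 d : ~~ (9 %| d)%Z -> (3 ^+ m.+1 %| d)%Z = false.
  by apply: contraNF; apply: dvdz_trans; case: (m) m0 => // m' _; rewrite !exprS mulrA dvdz_mulr.
have m3 x : ~~ (3 %| x)%Z -> (3 ^+ m %| x)%Z = false.
  by apply: contraNF; apply: dvdz_trans; case: (m) m0 => // m' _; rewrite !exprS dvdz_mulr.
have hunit c y : ~~ (3 %| c)%Z -> ~~ (3 %| h c y)%Z.
  move=> cu; rewrite /h -mulrA.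
  have : ~~ (3 %| T * c)%Z by rewrite dvd3M negb_or T3.
  by move: (T * c) (_ * p y) => a b; lia.
have hroot c : (3 %| c)%Z -> exists2 s, (3 %| s)%Z &
    forall y : int, (3 ^+ m %| 3 * y * h c y)%Z = (3 ^+ m %| 3 * y * (3 * y - s))%Z.
  move=> cd; apply: (@root_class m (h c) kappa kappa3 _ (hB c)).
  have : (3 %| T * c)%Z by exact: dvdz_mull.
  by rewrite /h -mulrA; move: (T * c) (_ * p 0) => a b; lia.
have [i uE] : exists i, u = 3 * i + 2 - r by exists ((u - 2 + r) %/ 3)%Z; lia.
case: ru => -[r0 _]; subst r.
  (* Modulo 3, [c0 = u (u + 1)] and [c1 = u (u + 2)]: exactly one of them vanishes, [c0] when
     [u = 2] and [c1] when [u = 1]. *)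
  have c0d : (3 %| c0)%Z by apply/dvdzP; exists (3 * i ^+ 2 + 5 * i + 2); rewrite /c0 uE; ring.
  have c1d : ~~ (3 %| c1)%Z.
    have /dvdzP[j jE] : (3 %| c1 - 2)%Z.
      by apply/dvdzP; exists (u ^+ 3 + 12 * i ^+ 2 + 18 * i + 6); rewrite /c1 uE; ring.
    by lia.
  have [s s3 hs] := hroot _ c0d; exists s; first by rewrite subr0.
  move=> k; have [y [->|[->|->]]] := kdec k => yN.
  - rewrite -/(defect _) D0; last by lia.
    rewrite hs -[LHS](@Gauss_dvdz_exp3 m (3 * y%:Z - 1)); last by lia.
    by congr (_ %| _)%Z; rewrite y3; ring.
  - rewrite -/(defect _) D1; last by lia.
    rewrite mulrC Gauss_dvdz_exp3 ?hunit //.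
    rewrite -[LHS](@Gauss_dvdz_exp3 m (3 * y%:Z + 1)); last by lia.
    rewrite -[LHS](@Gauss_dvdz_exp3 m (3 * y%:Z + 1 - s)); last by lia.
    by congr (_ %| _)%Z; rewrite y31; ring.
  by rewrite m9 ?D2 // m3 // !dvd3M; lia.
have c0d : ~~ (3 %| c0)%Z.
  have /dvdzP[j jE] : (3 %| c0 - 2)%Z.
    by apply/dvdzP; exists (3 * i ^+ 2 + 3 * i); rewrite /c0 uE; ring.
  by lia.
have c1d : (3 %| c1)%Z.
  by apply/dvdzP; exists (u ^+ 3 + 12 * i ^+ 2 + 10 * i + 2); rewrite /c1 uE; ring.
(* Here [k = 3y + 1], so the root in the variable [3y] is shifted by 1. *)
have [s s3 hs] := hroot _ c1d; exists (1 + s); first by lia.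
move=> k; have [y [->|[->|->]]] := kdec k => yN.
- rewrite -/(defect _) D0; last by lia.
  rewrite mulrC Gauss_dvdz_exp3 ?hunit //.
  rewrite -[LHS](@Gauss_dvdz_exp3 m (3 * y%:Z - 1)); last by lia.
  rewrite -[LHS](@Gauss_dvdz_exp3 m (3 * y%:Z - 1 - s)); last by lia.
  by congr (_ %| _)%Z; rewrite y3; ring.
- rewrite -/(defect _) D1; last by lia.
  rewrite hs -[LHS](@Gauss_dvdz_exp3 m (3 * y%:Z + 1)); last by lia.
  by congr (_ %| _)%Z; rewrite y31; ring.
by rewrite m9 ?D2 // m3 // !dvd3M; lia.
Qed.

(** * Vanishing of residues of 3-adic integers *)

Lemma res_at0 (x : Z3) : x 0%N = 0.
Proof. by rewrite -res_mod expr0 modz1. Qed.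

Lemma res0_dvd (x : Z3) (e n : nat) : (e <= n)%N -> x e = 0 <-> (3 ^+ e %| x n)%Z.
Proof. by move=> en; rewrite -(res_le_mod x en); split=> /dvdz_mod0P. Qed.

Lemma resM0_dvd (x y : Z3) (e n : nat) : (e <= n)%N ->
  (x * y) e = 0 <-> (3 ^+ e %| x n * y n)%Z.
Proof.
move=> en; rewrite -(rwP dvdz_mod0P) resM -(res_le_mod x en) -(res_le_mod y en).
by rewrite modzMml modzMmr.
Qed.

Lemma resN0 (x : Z3) (e : nat) : (- x) e = 0 <-> x e = 0.
Proof. by rewrite -!multiples3P; split=> -[y _ yE]; exists (- y); rewrite ?mulrN ?yE ?opprK. Qed.

Lemma resB0 (x y : Z3) (e : nat) : (x - y) e = 0 <-> x e = y e.
Proof. by rewrite -eqmod3P -multiples3P. Qed.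

Lemma resD0 (x y : Z3) (e : nat) : x e = 0 -> (x + y) e = 0 <-> y e = 0.
Proof. by move=> x0; rewrite resD x0 add0r res_mod. Qed.

Lemma resM0 (x y : Z3) (a b e : nat) : (e <= a + b)%N ->
  x a = 0 -> y b = 0 -> (x * y) e = 0.
Proof.
move=> eab /multiples3P[x' _ <-] /multiples3P[y' _ <-].
apply: (res_eq0_le eab); apply/multiples3P; exists (x' * y') => //.
by rewrite exprD; ring.
Qed.

Lemma resM0_exact (x y : Z3) (a b : nat) : x a = 0 -> x a.+1 <> 0 ->
  (x * y) (a + b)%N = 0 <-> y b = 0.
Proof.
move=> xa xa1; split=> [|yb]; last exact: (resM0 (leqnn _) xa yb).
(* Level [a + b + 1] is used so that, even for [b = 0], the quotient of [x] by [3^a] is still known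
   modulo 3. *)
have ltan : (a.+1 <= (a + b).+1)%N by rewrite ltnS leq_addr.
have /dvdzP[X XE] : (3 ^+ a %| x (a + b).+1)%Z by apply/res0_dvd; rewrite // ltnW.
have X3 : ~~ (3 %| X)%Z.
  apply/negP => /dvdzP[X' X'E]; apply/xa1/(res0_dvd _ ltan).
  by rewrite XE X'E exprS -mulrA dvdz_mull.
move=> /(resM0_dvd _ _ (leqnSn _)); rewrite XE exprD mulrAC [_ * 3 ^+ b]mulrC.
rewrite dvdz_mul2r ?expf_neq0 // Gauss_dvdz_exp3 // => yb.
by apply/(@res0_dvd _ _ (a + b).+1); rewrite // leqW ?leq_addl.
Qed.

Lemma res_neq0_exact (x : Z3) (c : nat) : x c <> 0 ->
  exists2 a, (a < c)%N & x a = 0 /\ x a.+1 <> 0.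
Proof.
elim: c => [|c IH] xc; first by case: xc; exact: res_at0.
have [xc0|/IH[a ac xa]] := pselect (x c = 0); first by exists c.
by exists a => //; apply: leqW.
Qed.

Lemma res_unit_mul0 (x y : Z3) (e : nat) : x 1%N <> 0 -> (x * y) e = 0 <-> y e = 0.
Proof. by move=> x1; apply: (@resM0_exact x y 0 e (res_at0 x) x1). Qed.

(** * Modular fixed points as roots of a cubic *)

(** Continuity allows replacing [z] by a natural number close to it; q-integers modulo [3^n] are
    periodic of period [3^n], so only [z n] matters. *)
Lemma iota_q_res (q z : Z3) (n : nat) : U 1 q ->
  iota_q q z n = (\sum_(i < `|z n|%N) q ^+ i) n.
Proof.
move=> Uq; have [/Z3_continuousP cq iq] := iota_qP Uq; have [l lE] := cq z n.
have e : ((`|z (maxn l n)|%N)%:R : Z3) (maxn l n) = z (maxn l n) by exact: natr_res.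
rewrite -(lE _ (res_le (leq_maxl l n) e)) iq; apply: qint_mod => //.
have : (`|z (maxn l n)|%N%:Z = `|z n|%N %[mod 3 ^+ n])%Z.
  by rewrite !gez0_abs ?res_ge0 // res_le_mod ?leq_maxr // res_mod.
by rewrite -[3 ^+ n](@natrX int 3 n) natz !modz_nat => -[].
Qed.

Lemma modular_fixed_pointP (q z : Z3) (n : nat) : U 1 q ->
  modular_fixed_point q n z <->
  (3 ^+ n %| \sum_(i < `|z n|%N) (q n) ^+ i - `|z n|%N%:Z)%Z.
Proof.
move=> Uq; rewrite /modular_fixed_point /= eqmod3P iota_q_res // res_sum.
have -> : ((\sum_(i < `|z n|) (q ^+ i) n) %% 3 ^+ n)%Z =
          ((\sum_(i < `|z n|) (q n) ^+ i) %% 3 ^+ n)%Z.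
  elim: `|z n|%N => [|k IH]; first by rewrite !big_ord0.
  by rewrite !big_ord_recr /= -modzDml IH resX modzDm.
rewrite gez0_abs ?res_ge0 // -eqz_mod_dvd res_mod.
by split=> /eqP.
Qed.

(** Applies [defect_root] to the representative of [z] modulo [3^(m+1)]. The cubic is read one level
    lower because the defect carries an extra factor 3. The root [s] is an integer that depends on
    [m]. *)
Lemma modular_fixed_point_cubic (m : nat) (q : Z3) (r : int) : (0 < m)%N -> U 1 q ->
  (r = 0 /\ (9 %| q m.+1 - 7)%Z) \/ (r = 1 /\ (9 %| q m.+1 - 4)%Z) ->
  exists2 s : Z3, (s - Z3_of_int r) 1%N = 0 & forall z : Z3,
    modular_fixed_point q m.+1 z <-> (z * (z - 1) * (z - s)) m = 0.
Proof.
move=> m0 Uq qr; have [u uE] : exists u, q m.+1 = 1 + 3 * u.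
  by exists ((q m.+1 - 1) %/ 3)%Z; lia.
have [|s sr hs] := @defect_root m u r m0; first by lia.
exists (Z3_of_int s) => [|z].
  by apply/resB0; rewrite /=; apply/eqP; rewrite eqz_mod_dvd expr1.
set d : int := 3 ^+ m; have subE (k t : int) : ((k - (t %% d)%Z) %% d)%Z = ((k - t) %% d)%Z.
  by rewrite -modzDmr modzNm modzDmr.
have zE := res_le_mod z (leqnSn m).
have zlt : (`|z m.+1| <= 3 ^ m.+1)%N.
  have := @ltz_pmod (z m.+1) (3 ^+ m.+1); rewrite exprn_gt0 // res_mod => /(_ isT).
  rewrite -[X in _ < X](@natrX int 3 m.+1) natz => h.
  by rewrite -lez_nat gez0_abs ?res_ge0 // ltW.
rewrite modular_fixed_pointP // uE hs // gez0_abs ?res_ge0 //.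
rewrite -(rwP dvdz_mod0P) 2!resM !resB res1 -zE /= !subE !modzDml.
by rewrite -/d modzMm -[in X in _ <-> X]modzMml modzMm modzMml; split.
Qed.

(** * Roots of the cubic modulo [3^m] *)

Lemma cubic_root_classes (m : nat) (s z : Z3) : (0 < m)%N -> s 1%N = 0 ->
  (z * (z - 1) * (z - s)) m = 0 <->
  (z 1%N = 0 /\ (z * (z - s)) m = 0) \/ (z - 1) m = 0.
Proof.
move=> m0 s1; have z13 : (z 1%N = 0) \/ (z 1%N = 1) \/ (z 1%N = 2).
  by have := res_mod z 1; rewrite expr1; lia.
have m1 (x : Z3) : x m = 0 -> x 1%N = 0 by apply: res_eq0_le.
have zsE : (z - s) 1%N = z 1%N by rewrite resB s1 subr0 res_mod.
have z1E : (z - 1) 1%N = ((z 1%N - 1) %% 3)%Z.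
  by rewrite resB res1 -modzDmr modzNm modzDmr.
rewrite [z * (z - 1)]mulrC -mulrA.
case: z13 => [z0|z12].
  have u1 : (z - 1) 1%N <> 0 by rewrite z1E z0.
  rewrite res_unit_mul0 //; split=> [|[[]|/m1]] //; by left.
have z1 : z 1%N <> 0 by case: z12 => ->.
have -> : ((z - 1) * (z * (z - s))) m = 0 <-> (z - 1) m = 0.
  by rewrite mulrC -mulrA !res_unit_mul0 ?zsE.
by split=> [|[[]|]]//; right.
Qed.

(** Here [c] is [m / 2] rounded up. Below level [c], [z] and [z - s] have the same valuation [a], so
    their product has valuation [2a < m]. *)
Lemma cubic_set_large_root (m c : nat) (s z : Z3) : (0 < m)%N -> c = (m.+1 %/ 2)%N ->
  s 1%N = 0 -> s c = 0 ->
  (z * (z - 1) * (z - s)) m = 0 <-> z c = 0 \/ (z - 1) m = 0.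
Proof.
move=> m0 cE s1 sc; rewrite cubic_root_classes //;
  suff -> : (z 1%N = 0 /\ (z * (z - s)) m = 0) <-> z c = 0 by [].
have zsc a : (a <= c)%N -> (z - s) a = 0 <-> z a = 0.
  by move=> ac; rewrite addrC resD0 //; apply/resN0/(res_eq0_le ac).
split=> [[_ zm]|zc]; last first.
  split; first by apply: res_eq0_le zc; lia.
  by apply: (@resM0 _ _ c c); rewrite ?zsc //; lia.
have [//|/res_neq0_exact[a ac [za za1]]] := pselect (z c = 0).
have : (z * (z - s)) (a + a.+1)%N = 0 by apply: res_eq0_le zm; lia.
by move=> /(resM0_exact _ _ za za1); rewrite zsc.
Qed.

(** For [z] divisible by 3, compare its valuation with that of [s], namely [w]. If it is larger,
    [z - s] has valuation [w]; if it is equal, the roles of [z] and [z - s] are exchanged; if it is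
    smaller, the product has valuation below [2w < m]. *)
Lemma cubic_set_small_root (m w : nat) (s z : Z3) : (w.*2 < m)%N ->
  s 1%N = 0 -> s w = 0 -> s w.+1 <> 0 ->
  (z * (z - 1) * (z - s)) m = 0 <->
  [\/ (z - s) (m - w)%N = 0, z (m - w)%N = 0 | (z - 1) m = 0].
Proof.
move=> wm s1 sw sw1; have m0 : (0 < m)%N by lia.
have w0 : (0 < w)%N by case: (w) sw1 => //; rewrite s1.
rewrite cubic_root_classes //;
  suff -> : (z 1%N = 0 /\ (z * (z - s)) m = 0) <-> (z - s) (m - w)%N = 0 \/ z (m - w)%N = 0.
  by split=> [[[]|]|[]]; [constructor 1|constructor 2|constructor 3|left; left|left; right|right].
have mw : (w.+1 <= m - w)%N by lia.
have zsw a : (a <= w)%N -> (z - s) a = 0 <-> z a = 0.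
  by move=> ac; rewrite addrC resD0 //; apply/resN0/(res_eq0_le ac).
split=> [[_ zm]|].
  have [zw1|/res_neq0_exact[a aw [za za1]]] := pselect (z w.+1 = 0).
    right; have zs1 : (z - s) w.+1 <> 0 by rewrite (resD0 _ zw1) resN0.
    have zs : (z - s) w = 0 by apply/zsw => //; apply: res_eq0_le zw1.
    by apply/(resM0_exact _ _ zs zs1); rewrite mulrC subnKC //; lia.
  have [aw'|aw'] := ltnP a w.
    have : (z * (z - s)) (a + a.+1)%N = 0 by apply: res_eq0_le zm; lia.
    by move=> /(resM0_exact _ _ za za1); rewrite zsw.
  left; apply/(resM0_exact _ _ za za1); apply: res_eq0_le zm; lia.
move=> h; have zw : z w = 0.
  by case: h => [/(@res_eq0_le _ _ w)|/(@res_eq0_le _ _ w)]; rewrite ?zsw //; apply; lia.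
split; first exact: res_eq0_le zw.
case: h => h; first by apply: (@resM0 _ _ w (m - w)) => //; lia.
by apply: (@resM0 _ _ (m - w) w) => //; [lia | apply/zsw].
Qed.

(** The unknown root [s] is eliminated in favour of [z0]: either [s] vanishes to level [m / 2]
    rounded up, which forces [2 v0 >= m], or minimality gives [s] the valuation [v0] and [z0 = s]
    modulo [3^(m - v0)]. *)
Lemma cubic_set (m v0 : nat) (s z0 : Z3) (S : set Z3) : (0 < m)%N -> s 1%N = 0 ->
  (forall z, S z <-> (z * (z - 1) * (z - s)) m = 0) -> S z0 ->
  (z0 * (z0 - 1)) v0 = 0 -> (z0 * (z0 - 1)) v0.+1 <> 0 ->
  (forall z, S z -> (z * (z - 1)) 1%N = 0 -> (z * (z - 1)) v0 = 0) ->
  forall z, S z <->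
    if (v0.*2 < m)%N then
      ((z - z0) (m - v0)%N = 0 \/ z (m - v0)%N = 0) \/ (z - 1) m = 0
    else z (m.+1 %/ 2)%N = 0 \/ (z - 1) m = 0.
Proof.
move=> m0 s1 SE Sz0 z0v z0v1 vmin z.
have unit1 (x : Z3) : x 1%N = 0 -> (x - 1) 1%N <> 0.
  by move=> x1; rewrite resD0 // => /resN0.
have unit2 (x : Z3) : (x - 1) 1%N = 0 -> x 1%N <> 0 by move=> x1 /unit1.
have z0cases := SE z0; have := z0cases.1 Sz0; rewrite (cubic_root_classes _ m0 s1) => {}z0cases.
have [sc|/res_neq0_exact[w wc [sw sw1]]] := pselect (s (m.+1 %/ 2)%N = 0).
  rewrite ifF; first by rewrite SE; apply: cubic_set_large_root.
  apply/negbTE; rewrite -leqNgt leqNgt; apply/negP => v0m; apply: z0v1.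
  have [zc|zm] := (cubic_set_large_root z0 m0 erefl s1 sc).1 ((SE z0).1 Sz0).
    by apply: (resM0 _ zc (res_at0 _)); lia.
  by apply: (resM0 _ (res_at0 _) zm); lia.
have w0 : (0 < w)%N by case: (w) sw1 => //; rewrite s1.
(* The root [s] itself lies in [S], so minimality yields [v0 <= w]. *)
have Ss : S s by apply/SE; rewrite subrr mulr0 res0.
have swv : s v0 = 0.
  apply/(res_unit_mul0 _ _ (unit1 _ s1)); rewrite mulrC; apply: vmin => //.
  by rewrite mulrC; apply/res_unit_mul0; first exact: unit1.
have v0w : (v0 <= w)%N.
  by rewrite leqNgt; apply/negP => /res_eq0_le/(_ swv).
have wm : (w.*2 < m)%N by lia.
have ltv0 : (v0.*2 < m)%N by lia.
rewrite ltv0; case: z0cases => [[z01 z0s]|z0m]; last first.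
  by case: z0v1; apply: (resM0 _ (res_at0 _) z0m); lia.
have z0v' : z0 v0 = 0 by apply/(res_unit_mul0 _ _ (unit1 _ z01)); rewrite mulrC.
have z0v1' : z0 v0.+1 <> 0.
  by move=> h; apply: z0v1; apply: (resM0 _ h (res_at0 _)); rewrite addn0.
have z0s' : (z0 - s) (m - v0)%N = 0.
  by apply/(resM0_exact _ _ z0v' z0v1'); rewrite subnKC //; lia.
(* As [v0 + 1 <= m - v0], the congruence of [z0] and [s] would carry a larger valuation of [s] over
   to [z0]. *)
have wE : w = v0.
  apply/eqP; rewrite eqn_leq v0w andbT leqNgt; apply/negP => vw.
  apply: z0v1'; have sv : s v0.+1 = 0 by apply: res_eq0_le sw.
  by apply/(resD0 _ ((resN0 _ _).2 sv)); rewrite addrC; apply: res_eq0_le z0s'; lia.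
subst w; rewrite SE (cubic_set_small_root _ ltv0 s1 sw sw1).
have -> : (z - z0) (m - v0)%N = 0 <-> (z - s) (m - v0)%N = 0.
  by rewrite -(resD0 (z - z0) z0s') addrC addrA subrK.
by split=> [[]|[[]|]]; [left; left|left; right|right|constructor 1|constructor 2|constructor 3].
Qed.

(** * Valuations, and the sets of modular fixed points *)

Lemma v3_ge_res0 (x : Z3) (v : nat) : (v%:Z%:E <= v3 x)%E -> x v = 0.
Proof.
move=> vx; have [//|/res_neq0_exact[a av [xa xa1]]] := pselect (x v = 0).
have xE : v3 x = a%:Z%:E by apply/v3P; rewrite !multiples3P.
by move: vx; rewrite xE lee_fin lez_nat leqNgt av.
Qed.

Lemma ltr_half_pred (v n : nat) : (0 < n)%N ->
  (v%:R < (n%:R - 1) / 2%:R :> rat) = (v.*2 < n.-1)%N.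
Proof.
case: n => // n _; rewrite -natr1 addrK ltr_pdivlMr // -natrM ltr_nat.
by rewrite muln2.
Qed.

Lemma eqmod9_res (q : Z3) (a n : nat) : (2 <= n)%N ->
  eqmod 9%:R q a%:R -> (9 %| q n - a%:Z)%Z.
Proof.
move=> n2; have -> : 9%:R = 3%:R ^+ 2 :> Z3 by rewrite -natrX.
by rewrite eqmod3P res_nat -(res_le_mod q n2) => e; rewrite -eqz_mod_dvd; apply/eqP.
Qed.

Theorem theorem5p8 (n : nat) (hn : (2 <= n)%N)
    (q : Z3) (hq : (U 1 `\` U 2) q)
    (z0 : Z3) (hz0 : modular_fixed_point q n z0)
    (v0 : nat) (hv0 : v3 (z0 * (z0 - 1)) = v0%:Z%:E) (hv0_neq0 : v0 <> 0%N)
    (hv0_min : forall z : Z3, modular_fixed_point q n z ->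
       v3 (z * (z - 1)) <> 0%:E -> (v0%:Z%:E <= v3 (z * (z - 1)))%E) :
  let tau : Z3 := 3%:R ^+ (n - v0 - 1) in
  (eqmod 9%:R q 7%:R ->
    modular_fixed_point q n =
    if (v0%:R < (n%:R - 1) / 2%:R :> rat) then
      coset z0 tau `|` multiples tau `|` coset 1 (3%:R ^+ (n - 1))
    else
      multiples (3%:R ^+ (n %/ 2)) `|` coset 1 (3%:R ^+ (n - 1))) /\
  (eqmod 9%:R q 4%:R ->
    modular_fixed_point q n =
    if (v0%:R < (n%:R - 1) / 2%:R :> rat) then
      coset z0 tau `|` coset 1 tau `|` multiples (3%:R ^+ (n - 1))
    else
      coset 1 (3%:R ^+ (n %/ 2)) `|` multiples (3%:R ^+ (n - 1))).
Proof.
have [Uq _] := hq; case: n hn hz0 hv0_min => // m hm hz0 vmin tau.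
have m0 : (0 < m)%N by [].
have tauE : tau = 3%:R ^+ (m - v0) by rewrite /tau; congr (_ ^+ _); lia.
rewrite {}tauE ltr_half_pred // subSS subn0 /=.
move: hv0 => /v3P; rewrite !multiples3P => -[z0v z0v1].
have {}vmin z : modular_fixed_point q m.+1 z -> (z * (z - 1)) 1%N = 0 ->
    (z * (z - 1)) v0 = 0.
  move=> /vmin h z1; apply/v3_ge_res0/h => /(v3P _ 0)[_]; apply.
  exact/multiples3P.
have cosetB e x y : coset y (3%:R ^+ e) x <-> (x - y) e = 0.
  by rewrite coset3P resB0.
split=> [/(eqmod9_res hm) q9|/(eqmod9_res hm) q9].
  have [s s1 sE] := modular_fixed_point_cubic m0 Uq (or_introl (conj erefl q9)).
  have {}s1 : s 1%N = 0 by rewrite -s1 [Z3_of_int 0](_ : _ = 0) ?subr0.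
  have := cubic_set m0 s1 sE hz0 z0v z0v1 vmin.
  by case: ifP => _ h; apply/funext => z; apply/propext; rewrite h /setU /= !cosetB !multiples3P.
have [s s1 sE] := modular_fixed_point_cubic m0 Uq (or_intror (conj erefl q9)).
(* The reflection [z |-> 1 - z] preserves [z (z - 1)] and moves the root [s = 1] modulo 3 to
   [1 - s = 0] modulo 3, so [cubic_set] applies to the reflected set of fixed points. *)
have oneB e (x y : Z3) : ((1 - x) - (1 - y)) e = 0 <-> (x - y) e = 0.
  by rewrite (_ : _ - _ = - (x - y)) ?resN0 //; ring.
have one1 e (x : Z3) : (1 - x) e = 0 <-> (x - 1) e = 0 by rewrite -opprB resN0.
have one2 e (x : Z3) : (1 - x - 1) e = 0 <-> x e = 0 by rewrite addrC addKr resN0.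
have oneM (x : Z3) : (1 - x) * (1 - x - 1) = x * (x - 1) by ring.
have s1' : (1 - s) 1%N = 0.
  by apply/one1; rewrite [Z3_of_int 1](_ : _ = 1) in s1.
have sE' z : modular_fixed_point q m.+1 (1 - z) <-> (z * (z - 1) * (z - (1 - s))) m = 0.
  have e : (1 - z) * (1 - z - 1) * (1 - z - s) = - (z * (z - 1) * (z - (1 - s))) by ring.
  by rewrite sE e; exact: resN0.
have := @cubic_set m v0 (1 - s) (1 - z0) (fun z => modular_fixed_point q m.+1 (1 - z)) m0 s1' sE'.
rewrite subKr oneM => /(_ hz0 z0v z0v1) fix1.
have {fix1}/fix1 : forall z, modular_fixed_point q m.+1 (1 - z) ->
    (z * (z - 1)) 1%N = 0 -> (z * (z - 1)) v0 = 0.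
  by move=> z Sz; rewrite -oneM; apply: vmin.
by case: ifP => _ h; apply/funext => z; apply/propext; have := h (1 - z);
  rewrite subKr ?oneB one1 one2 => ->; rewrite /setU /= !cosetB !multiples3P.
Qed.
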